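(* Let $n\ge 3$ be an integer, let $\mathcal{D}_{2n}$ be the dihedral group of order $2n$, and let $\lambda_1(\mathcal{P}(\mathcal{D}_{2n}))$ denote the spectral radius of its power graph. Let $D_{avg}$ be the average degree of the power graph $\mathcal{P}(C_n)$ of the cyclic group $C_n$ of order $n$. Then $$\frac{1}{2}\left[D_{avg}+\sqrt{D_{avg}^{2}+4}\right] \le \lambda_{1}(\mathcal{P}(\mathcal{D}_{2n}))\le n.$$
   Context: The power graph $\mathcal{P}(\mathbb{G})$ of a finite group $\mathbb{G}$ is the simple undirected graph with vertex set $\mathbb{G}$ in which two distinct elements $x,y$ are adjacent if and only if one of them is an integral power of the other. The dihedral group is $\mathcal{D}_{2n}=\langle a,b \mid a^n=e,\ b^2=e,\ ba=a^{-1}b\rangle$, of order $2n$. The average degree of a graph is the arithmetic mean of its vertex degrees. The spectral radius $\lambda_1(G)$ of a graph $G$ is the largest eigenvalue of its adjacency matrix. *)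

(* Defs.v *)
From HB Require Import structures.
From mathcomp Require Import all_boot all_order all_algebra all_fingroup.
From mathcomp Require Import all_solvable.

Set Implicit Arguments.
Unset Strict Implicit.
Unset Printing Implicit Defensive.

Import Order.TTheory GRing.Theory Num.Theory.
Local Open Scope ring_scope.

(* The cycle <[x]> is the set of all integral powers of x. *)
Definition power_graph (gT : finGroupType) : rel gT :=
  fun x y => (x != y) && ((x \in <[y]>%g) || (y \in <[x]>%g)).

Arguments power_graph gT : clear implicits.

Lemma power_graph_sym gT : symmetric (power_graph gT).
Proof. by move=> x y; rewrite /power_graph eq_sym orbC. Qed.

Lemma power_graph_irr gT : irreflexive (power_graph gT).
Proof. by move=> x; rewrite /power_graph eqxx. Qed.

Definition degree (T : finType) (e : rel T) (x : T) : nat := #|[set y | e x y]|.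

Definition average_degree (R : rcfType) (T : finType) (e : rel T) : R :=
  (\sum_(x : T) (degree e x)%:R) / #|T|%:R.

Arguments average_degree R {T} e.

(* Vertices are numbered by the enumeration of T; another numbering would
   conjugate the matrix by a permutation. *)
Definition adjacency_matrix (R : rcfType) (T : finType) (e : rel T) :
    'M[R]_#|T| :=
  \matrix_(i, j) (e (enum_val i) (enum_val j))%:R.

Arguments adjacency_matrix R {T} e.

Definition is_spectral_radius (R : rcfType) (T : finType) (e : rel T)
    (lambda : R) : Prop :=
  eigenvalue (adjacency_matrix R e) lambda /\
  (forall mu : R, eigenvalue (adjacency_matrix R e) mu -> mu <= lambda).

Lemma is_spectral_radius_unique (R : rcfType) (T : finType) (e : rel T)
    (l m : R) :
  is_spectral_radius e l -> is_spectral_radius e m -> l = m.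
Proof.
by move=> [El maxl] [Em maxm]; apply/le_anti; rewrite maxm // maxl.
Qed.

(* Main.v *)
Require Import Defs.
From HB Require Import structures.
From mathcomp Require Import all_boot all_order all_algebra all_fingroup.
From mathcomp Require Import all_solvable.
From mathcomp Require Import sesquilinear spectral complex.
From mathcomp Require Import ring.

Set Implicit Arguments.
Unset Strict Implicit.
Unset Printing Implicit Defensive.

Import Order.TTheory GRing.Theory Num.Theory.
Local Open Scope ring_scope.
Local Open Scope sesquilinear_scope.

(** The upper and lower bounds hold because the power graph of the dihedral
    group is the power graph of its rotation subgroup C, of order n, with n
    pendant vertices hung on the identity. Indeed a reflection y is an
    involution, so its only other power is 1, and it is a power of nothing
    but itself; see [dihedral_structure] and
    [power_graph_outside_involution]. The rotations induce a copy of the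
    power graph of Z/n by [average_degree_cyclic].

    The rest concerns any graph made of n vertices C and n pendant vertices
    attached to one vertex v of C ([pendant_spectral_bounds]). Both bounds
    come from test vectors that are constant on C and constant off C.

    For the lower bound, the spectral theorem gives a largest eigenvalue that
    dominates every Rayleigh quotient ([spectral_radius_rayleigh]). On vectors
    equal to a on C and to b off C the adjacency form is n (d a^2 + 2 a b),
    with d the average degree inside C, and the squared norm is
    n (a^2 + b^2). So these quotients are those of the 2 x 2 matrix with rows
    (d, 1) and (1, 0), whose larger eigenvalue is the positive root t of
    t^2 = d t + 1, that is the claimed bound; it is reached at (a, b) = (t, 1).

    For the upper bound, a positive vector w with A w <= c w entrywise bounds
    all eigenvalues by c ([eigenvalue_le_supersolution]). With w = n on C and
    w = 1 off C, such an inequality holds for c = n: at v the n pendant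
    neighbours weigh only n in all, which together with at most n - 1
    neighbours of weight n in C makes n * n. *)

(** * Largest eigenvalue of a graph *)

(** Extending scalars to R[i] makes the unitary diagonalization of Hermitian
    matrices available. The diagonal is real, hence comes from eigenvalues
    over R, and a unitary change of coordinates turns the form into a weighted
    sum of squared moduli. *)
Lemma symmetric_rayleigh (R : rcfType) (n : nat) (A : 'M[R]_n) :
  (0 < n)%N -> A^T = A ->
  exists2 l : R, eigenvalue A l &
    forall u : 'rV[R]_n, (u *m A *m u^T) 0 0 <= l * (u *m u^T) 0 0.
Proof.
case: n A => [//|n] A _ symA.
pose toC := real_complex R; pose AC := map_mx toC A.
have realC m p (M : 'M[R]_(m, p)) : map_mx toC M \is a mxOver Num.real.
  by apply/mxOverP => i j; rewrite mxE; apply/complex_realP; exists (M i j).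
have hermA : AC \is hermsymmx.
  apply: realsym_hermsym; last exact: realC.
  apply/is_hermitianmxP; rewrite expr0 scale1r.
  by rewrite (map_mx_id (fun x => erefl)) map_trmx symA.
set P := spectralmx AC; set d := spectral_diag AC.
have uP : P \is unitarymx := spectral_unitarymx AC.
have defA : AC = P^t* *m diag_mx d *m P.
  rewrite -(invmx_unitary uP).
  exact/orthomx_spectralP/hermitian_normalmx.
pose r i : R := complex.Re (d 0 i).
have dE i : d 0 i = toC (r i).
  by rewrite /toC RRe_real // (mxOverP (hermitian_spectral_diag_real hermA)).
have [k _ maxk] : exists2 k, true & forall i, r i <= r k.
  case: (arg_maxP r (i0 := ord0) (P := xpredT)) => // k _ mk.
  by exists k => // i; exact: mk.
exists (r k).
  rewrite -(eigenvalue_map toC).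
  rewrite -[eigenvalue _ _]/(eigenvalue AC (toC (r k))) -dE.
  apply/eigenvalueP; exists (row k P); last first.
    apply/eqP=> Pk0; have /matrixP/(_ k k) := unitarymxP uP.
    rewrite mxE big1 => [|j _]; last first.
      by move/rowP/(_ j): Pk0; rewrite !mxE => ->; rewrite mul0r.
    by rewrite mxE eqxx => /esym/eqP; rewrite oner_eq0.
  rewrite -row_mul defA !mulmxA (unitarymxP uP) mul1mx.
  by apply/rowP=> j; rewrite mul_diag_mx !mxE.
move=> u; pose uC := map_mx toC u; pose w := uC *m P^t*.
have conju : uC^t* = map_mx toC u^T.
  by rewrite map_trmx realmxC ?realC // -map_trmx.
have conjw : w^t* = P *m uC^t* by rewrite /w trmx_mul map_mxM trmxCK.
rewrite -lecR rmorphM /= -/toC.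
have mapE (M : 'M[R]_1) : toC (M 0 0) = (map_mx toC M) 0 0 by rewrite mxE.
rewrite !mapE !map_mxM -/uC -/AC -conju.
have -> : uC *m AC *m uC^t* = w *m diag_mx d *m w^t*.
  by rewrite defA conjw /w !mulmxA.
have -> : uC *m uC^t* = w *m w^t*.
  by rewrite conjw /w -!mulmxA (mulmxA _ P) (mulmx1C (unitarymxP uP)) mul1mx.
(* In the eigenbasis the claim is termwise: r i * |w i|^2 <= r k * |w i|^2. *)
move: w {conjw} => w; rewrite !mxE mulr_sumr; apply: ler_sum => i _.
rewrite mul_mx_diag !mxE dE (mulrC (w 0 i)) -!mulrA.
by rewrite ler_wpM2r ?mul_conjC_ge0 // lecR.
Qed.

Definition neighbour_sum (R : rcfType) (T : finType) (e : rel T) (f : T -> R)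
    x :=
  \sum_y (e x y)%:R * f y.

Lemma neighbour_sum_mulmx (R : rcfType) (T : finType) (e : rel T)
    (f : T -> R) i :
  symmetric e ->
  ((\row_j f (enum_val j)) *m adjacency_matrix R e) 0 i
    = neighbour_sum e f (enum_val i).
Proof.
move=> sym_e; rewrite mxE /neighbour_sum.
rewrite (reindex _ (onW_bij _ (@enum_val_bij T))) /=.
by apply: eq_bigr => j _; rewrite !mxE sym_e mulrC.
Qed.

(** The inequality at an eigenvector also shows that l is the largest
    eigenvalue, so that one witness serves both claims. *)
Lemma spectral_radius_rayleigh (R : rcfType) (T : finType) (e : rel T) :
  (0 < #|T|)%N -> symmetric e ->
  exists2 l : R, is_spectral_radius e l &
    forall f : T -> R, \sum_x neighbour_sum e f x * f x <= l * \sum_x f x ^+ 2.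
Proof.
move=> T0 sym_e; pose A := adjacency_matrix R e.
have symA : A^T = A by apply/matrixP=> i j; rewrite !mxE sym_e.
have [l El ray] := symmetric_rayleigh T0 symA; exists l; first split=> // mu.
  case/eigenvalueP=> u uA u0; have := ray u.
  rewrite uA -scalemxAl [leLHS]mxE ler_pM2r // mxE lt_def.
  rewrite psumr_eq0 ?sumr_ge0 => [|i _|i _]; rewrite ?mxE -?expr2 ?sqr_ge0 //.
  rewrite andbT; apply: contra u0 => /allP u0; apply/eqP/rowP=> i.
  have := u0 i (mem_index_enum _); rewrite !mxE -expr2 sqrf_eq0.
  by move/eqP.
move=> f; have := ray (\row_j f (enum_val j)).
rewrite [leLHS]mxE [(_ *m _^T) 0 0]mxE.
rewrite !(reindex _ (onW_bij _ (@enum_val_bij T))) /=.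
under eq_bigr do rewrite neighbour_sum_mulmx // !mxE.
by under [X in _ <= l * X]eq_bigr do rewrite !mxE -expr2.
Qed.

(** Perron-style comparison: let u be an eigenvector and let k maximize
    |u k| / w k =: q. Then |u| <= q w everywhere with equality at k, and
    reading A u = mu u at k gives mu * q * w k <= q * (A w) k. *)
Lemma eigenvalue_le_supersolution (R : rcfType) (T : finType) (e : rel T)
    (w : T -> R) (c mu : R) :
  symmetric e -> (forall x, 0 < w x) ->
  (forall x, neighbour_sum e w x <= c * w x) ->
  eigenvalue (adjacency_matrix R e) mu -> mu <= c.
Proof.
move=> sym_e w0 super /eigenvalueP[u uA u0].
pose f x := u 0 (enum_rank x).
have uE : u = \row_j f (enum_val j).
  by apply/rowP=> j; rewrite mxE /f enum_valK.
have eig x : neighbour_sum e f x = mu * f x.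
  have /rowP/(_ (enum_rank x)) := uA.
  by rewrite uE neighbour_sum_mulmx // !mxE enum_rankK.
have /rV0Pn[j0 fj0] := u0.
pose q x := `|f x| / w x.
case: (arg_maxP q (i0 := enum_val j0) (P := xpredT)) => // k _ maxk.
have fle x : `|f x| <= q k * w x by rewrite -ler_pdivrMr //; exact: maxk.
have qk0 : 0 < q k.
  apply: lt_le_trans (maxk (enum_val j0) isT).
  by rewrite divr_gt0 // normr_gt0 /f enum_valK.
have fk : `|f k| = q k * w k by rewrite /q divfK ?gt_eqF.
have : mu * `|f k| <= q k * neighbour_sum e w k.
  apply: le_trans (_ : `|neighbour_sum e f k| <= _).
    by rewrite eig normrM ler_wpM2r // ler_norm.
  apply: le_trans (ler_norm_sum _ _ _) _.
  rewrite /neighbour_sum mulr_sumr; apply: ler_sum => x _.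
  by rewrite normrM normr_nat mulrCA ler_wpM2l.
move/le_trans/(_ (ler_wpM2l (ltW qk0) (super k))).
by rewrite fk mulrCA ler_pM2l // ler_pM2r.
Qed.

(** * Graphs with pendant vertices at one vertex *)

Lemma neighbour_sum_pendant (R : rcfType) (T : finType) (e : rel T)
    (C : {set T}) (v : T) (a b : R) x :
  symmetric e -> v \in C -> (forall y z, y \notin C -> e y z = (z == v)) ->
  neighbour_sum e (fun y => if y \in C then a else b) x =
  if x \in C then a * \sum_(y in C) (e x y)%:R + b * ((x == v) * #|~: C|)%:R
  else a.
Proof.
move=> sym_e Cv pend; rewrite /neighbour_sum.
case: ifPn => [Cx | Cx]; last first.
  rewrite (bigD1 v) //= pend // eqxx Cv mul1r big1 ?addr0 // => y yv.
  by rewrite pend // (negPf yv) mul0r.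
rewrite (bigID (mem C)) /=; congr (_ + _).
  by rewrite mulr_sumr; apply: eq_bigr => y ->; rewrite mulrC.
rewrite (eq_bigr (fun=> b * (x == v)%:R)) => [|y Cy]; last first.
  by rewrite (negPf Cy) sym_e pend // mulrC.
rewrite sumr_const -mulrnAr natrM mulr_natr; congr (_ * (_ *+ _)).
by apply: eq_card => y; rewrite !inE.
Qed.

Lemma pendant_spectral_bounds (R : rcfType) (T : finType) (e : rel T)
    (C : {set T}) (v : T) (n : nat) :
  symmetric e -> irreflexive e -> v \in C ->
  (forall y z, y \notin C -> e y z = (z == v)) ->
  #|C| = n -> #|~: C| = n ->
  let d : R := (\sum_(x in C) \sum_(y in C) (e x y)%:R) / n%:R in
  exists2 l : R, is_spectral_radius e l &
    2^-1 * (d + Num.sqrt (d ^+ 2 + 4)) <= l <= n%:R.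
Proof.
move=> sym_e irr_e Cv pend cC cC' d.
have n0 : (0 < n)%N by rewrite -cC; apply/card_gt0P; exists v.
have nR0 : 0 < n%:R :> R by rewrite ltr0n.
have T0 : (0 < #|T|)%N by apply/card_gt0P; exists v.
have [l rad ray] := spectral_radius_rayleigh R T0 sym_e.
have sumC (a b : R) : \sum_x (if x \in C then a else b) = n%:R * (a + b).
  rewrite (bigID (mem C)) /= (eq_bigr (fun=> a)) => [|x ->] //.
  rewrite [X in _ + X](eq_bigr (fun=> b)) => [|x /negPf->] //.
  rewrite !sumr_const cC mulrDr !mulr_natl; congr (_ + _ *+ _).
  by rewrite -cC'; apply: eq_card => x; rewrite !inE.
exists l => //; apply/andP; split; last first.
  have [El _] := rad.
  (* The weights n : 1 make the total weight of the pendant vertices equal to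
     that of a single vertex of C. *)
  pose w y : R := if y \in C then n%:R else 1.
  apply: (eigenvalue_le_supersolution (w := w)) El => // [x | x].
    by rewrite /w; case: ifP.
  rewrite (neighbour_sum_pendant _ _ _ sym_e Cv pend) /w.
  case: ifP => [Cx|_]; last by rewrite mulr1.
  rewrite mul1r cC' (big_setD1 x) //= irr_e add0r.
  have le1 : \sum_(y in C :\ x) (e x y)%:R <= n.-1%:R :> R.
    rewrite -cC (cardsD1 x C) Cx add1n /= -sum1_card natr_sum.
    by apply: ler_sum => y _; rewrite ler_nat leq_b1.
  apply: (@le_trans _ _ (n%:R * n.-1%:R + n%:R)).
    by rewrite lerD ?ler_pM2l // ler_nat; case: eqP => _; rewrite ?mul1n.
  by rewrite -!natrM -natrD ler_nat -mulnSr prednK.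
set s := Num.sqrt _; set t := 2^-1 * _.
have s2 : s ^+ 2 = d ^+ 2 + 4 by rewrite sqr_sqrtr // addr_ge0 ?sqr_ge0.
(* The root of this quadratic makes the vector (t, 1) an eigenvector of the
   quotient matrix, so its Rayleigh quotient is exactly t. *)
have tE : t ^+ 2 = d * t + 1.
  by rewrite /t exprMn sqrrD s2; field.
clearbody t.
have := ray (fun y => if y \in C then t else 1).
under eq_bigr do rewrite (neighbour_sum_pendant _ _ _ sym_e Cv pend) mul1r cC'.
have -> : \sum_x (if x \in C then t else 1) ^+ 2 = n%:R * (t ^+ 2 + 1).
  by rewrite -sumC; apply: eq_bigr => x _; case: ifP; rewrite ?expr1n.
rewrite (bigID (mem C)) /=.
rewrite [X in _ + X](eq_bigr (fun=> t)) => [|x /negPf->]; last by rewrite mulr1.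
rewrite (eq_bigr (fun x => t ^+ 2 * (\sum_(y in C) (e x y)%:R)
    + t * ((x == v) * n)%:R)) => [|x ->]; last by ring.
rewrite big_split /= -!mulr_sumr.
have -> : \sum_(x in C) \sum_(y in C) (e x y)%:R = n%:R * d :> R.
  by rewrite /d mulrCA divff ?mulr1 // gt_eqF.
have -> : \sum_(x in C) ((x == v) * n)%:R = n%:R :> R.
  rewrite (bigD1 v) //= eqxx mul1n big1 ?addr0 // => x /andP[_ /negPf->].
  by rewrite mul0n.
rewrite sumr_const (_ : #|_| = n); last first.
  by rewrite -cC'; apply: eq_card => x; rewrite !inE.
have -> : t ^+ 2 * (n%:R * d) + t * n%:R + t *+ n = t * (n%:R * (t ^+ 2 + 1)).
  rewrite -mulr_natr {2}tE; ring.
by rewrite ler_pM2r // mulr_gt0 // ltr_wpDl ?sqr_ge0.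
Qed.

(** * Power graphs of cyclic and dihedral groups *)

Lemma power_graph_morphim (gT rT : finGroupType) (G : {group gT})
    (f : {morphism G >-> rT}) x y :
  ('injm f)%g -> x \in G -> y \in G ->
  power_graph rT (f x) (f y) = power_graph gT x y.
Proof.
move=> injf Gx Gy; rewrite /power_graph (inj_in_eq (injmP injf)) //.
have mem z t : z \in G -> t \in G -> (f z \in <[f t]>%g) = (z \in <[t]>%g).
  move=> Gz Gt; rewrite -morphim_cycle // -cycle_subG -morphim_cycle //.
  by rewrite injmSK ?cycle_subG.
by rewrite !mem.
Qed.

(** The right-hand side only mentions the edges of [power_graph gT] inside the
    subgroup, so that the average degree can be read off in any group having
    an element of order n. *)
Lemma average_degree_cyclic (R : rcfType) (gT : finGroupType) (r : gT) n :
  (1 < n)%N -> #[r]%g = n ->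
  average_degree R (power_graph 'Z_n) =
  (\sum_(x in <[r]>%g) \sum_(y in <[r]>%g) (power_graph gT x y)%:R) / n%:R.
Proof.
move=> n1 on; case: n / on n1 => n1.
rewrite /average_degree card_ord Zp_cast //; congr (_ / _).
pose f := Zpm_morphism r.
have Zin (k : 'Z_#[r]%g) : k \in Zp #[r]%g by rewrite /Zp n1 inE.
have sumZ (F : gT -> R) : \sum_(x in <[r]>%g) F x = \sum_k F (f k).
  rewrite -(im_Zpm r) morphimEdom big_imset; last exact: (injmP (injm_Zpm r)).
  by apply: eq_bigl => k; rewrite Zin.
rewrite sumZ; apply: eq_bigr => k _; rewrite sumZ /degree -sum1_card natr_sum.
rewrite big_mkcond /=; apply: eq_bigr => j _; rewrite inE.
by rewrite (power_graph_morphim (injm_Zpm r)) //; case: power_graph.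
Qed.

(** In the presentation x^n = y^2 = 1, x^y = x^-1, the group is the product of
    the cycles of x and y and has order 2 n, which forces x to have order
    exactly n. An element outside the cycle of x is x^i y, and
    x^i y x^i y = x^i x^-i = 1. *)
Lemma dihedral_structure n : (1 < n)%N ->
  exists2 r : gsort 'D_(2 * n)%N, #[r]%g = n &
    forall y, y \notin <[r]>%g -> (y ^+ 2 = 1)%g.
Proof.
move=> n1; rewrite mul2n.
have /(isoGrpP _ (Grp_dihedral n1)) := isog_refl 'D_n.*2%G.
case=> _; case/existsP=> -[x y] /= /eqP[defG xq y2 xy].
have {}defG : (<[x]> * <[y]> = 'D_n.*2)%g.
  by rewrite -norm_joinEr // norms_cycle xy groupV cycle_id.
have yV : (y^-1 = y)%g by apply/eqP; rewrite eq_invg_mul -(expgS y 1) y2.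
have ox : #[x]%g = n.
  apply/eqP; rewrite eqn_leq dvdn_leq ?order_dvdn ?xq ?(ltnW n1) //=.
  have oy : (#[y]%g <= 2)%N by rewrite dvdn_leq // order_dvdn y2.
  rewrite -(leq_pmul2r (isT : 0 < 2)%N) muln2.
  rewrite -[X in (X <= _)%N](card_dihedral n1).
  apply: leq_trans (leq_mul (leqnn _) oy).
  by rewrite /order (mul_cardG <[x]> <[y]>) defG leq_pmulr ?cardG_gt0.
exists x => // z x'z.
have : z \in (<[x]> * <[y]>)%g by rewrite defG inE.
case/imset2P=> _ _ /cycleP[i ->] /cycleP[j ->] zE.
have yj : (y ^+ j = if odd j then y else 1)%g.
  by rewrite -(expg_mod j y2) modn2; case: odd.
move: zE x'z; rewrite yj; case: odd => [-> _ | ->]; last first.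
  by rewrite mulg1 mem_cycle.
(* y inverts x^i by conjugation, and y is its own inverse. *)
rewrite expgS expg1 -mulgA (mulgA y) -{1}yV -mulgA.
rewrite -[(y^-1 * _)%g]/((x ^+ i) ^ y)%g.
by rewrite conjXg xy expgVn mulgV.
Qed.

(** An involution y outside G has 1 as its only power other than itself. It is
    not a power of an element of G, and an element outside G is itself an
    involution, whose powers are only itself and 1. *)
Lemma power_graph_outside_involution (gT : finGroupType) (G : {group gT})
    (y z : gT) :
  (forall y, y \notin G -> (y ^+ 2 = 1)%g) ->
  y \notin G -> power_graph gT y z = (z == 1%g).
Proof.
move=> invol G'y.
have cyc (u v : gT) : (u ^+ 2 = 1)%g -> v \in <[u]>%g -> v != u -> v = 1%g.
  move=> u2 /cycleP[j ->]; rewrite -(expg_mod j u2) modn2.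
  by case: odd; rewrite // eqxx.
have y1 : y != 1%g by apply: contraNneq G'y => ->; rewrite group1.
rewrite /power_graph; apply/idP/eqP => [/andP[yz]|->]; last first.
  by rewrite y1 group1 orbT.
case/orP=> [zy|yz']; last first.
  by apply: (cyc y) => //; rewrite ?invol // eq_sym.
have [Gz|G'z] := boolP (z \in G).
  by case/negP: G'y; apply: subsetP zy; rewrite cycle_subG.
by case/eqP: y1; apply: (cyc z) => //; rewrite invol.
Qed.

Theorem theorem2p5 (R : rcfType) (n : nat) (n_ge3 : (3 <= n)%N) :
  let Davg : R := average_degree R (power_graph 'Z_n) in
  exists lambda1 : R,
    is_spectral_radius (power_graph 'D_(2 * n)%N) lambda1 /\
    2^-1 * (Davg + Num.sqrt (Davg ^+ 2 + 4)) <= lambda1 <= n%:R.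
Proof.
have n1 : (1 < n)%N by apply: leq_trans n_ge3.
have [r or invol] := dihedral_structure n1.
rewrite (average_degree_cyclic R n1 or) /=.
have cD : #|[set: gsort 'D_(2 * n)%N]| = (2 * n)%N.
  by rewrite mul2n card_dihedral.
have cC' : #|~: <[r]>%g| = n.
  apply: (@addnI #|<[r]>%g|); rewrite cardsC -cardsT cD -/(#[r]%g) or.
  by rewrite addnn mul2n.
have [l rad bounds] := pendant_spectral_bounds R
  (@power_graph_sym _) (@power_graph_irr _) (group1 <[r]>%G)
  (fun y z => power_graph_outside_involution z invol) or cC'.
by exists l.
Qed.
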